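(* Let $\mathcal{A}$ and $\mathcal{S}$ be Sudoku grids. If $\mathcal{S}$ is a logically deducible solution of $\mathcal{A}$ then it is the only solution of $\mathcal{A}$.
   Context: A Sudoku proposition is a formal symbol $r_ic_j \not\approx d$ with $i,j,d\in\{1,\dots,9\}$. Sudoku formulas are built inductively from Sudoku propositions and the constants $\top,\bot$ using $\lnot,\land,\lor,\Rightarrow,\Leftrightarrow$. A grid is a $9\times 9$ matrix $\mathcal{A}=[A_{ij}]_{9\times 9}$ of nonempty subsets $A_{ij}\subseteq\{1,\dots,9\}$; it is full if $|A_{ij}|=1$ for all $i,j$. Satisfaction $\mathcal{A}\models\phi$: $\mathcal{A}\models\top$ always, $\mathcal{A}\models\bot$ never, $\mathcal{A}\models r_ic_j\not\approx d$ iff $d\notin A_{ij}$, and the connectives are interpreted classically. Write $r_ic_j\equiv d$ for $\bigwedge_{s\ne d} r_ic_j\not\approx s$, and $r_ic_j\parallel r_\ell c_m$ for $\bigwedge_{1\le d\le 9}((r_ic_j\equiv d\Rightarrow r_\ell c_m\not\approx d)\land(r_\ell c_m\equiv d\Rightarrow r_ic_j\not\approx d))$. The set $\Sigma_{ax}$ consists of 27 formulas, one for each row, each column and each of the nine standard $3\times 3$ boxes: the conjunction of $r_ic_j\parallel r_\ell c_m$ over all pairs of distinct cells in that row, column or box. A Sudoku grid is a grid $\mathcal{A}$ with $\mathcal{A}\models\phi$ for all $\phi\in\Sigma_{ax}$ (i.e. whenever $A_{ij}=\{d\}$, $d$ belongs to no $A_{\ell m}$ for another cell in the same row, column or box). A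 full Sudoku grid is a Sudoku grid that is full. A solution of a Sudoku grid $\mathcal{A}=[A_{ij}]$ is a full Sudoku grid $\mathcal{S}=[S_{ij}]$ with $S_{ij}\subseteq A_{ij}$ for all $i,j$. A Sudoku axiom is a Sudoku formula that holds in every full Sudoku grid; $\Delta_{ax}$ is the set of all Sudoku axioms. For a set $\Phi$ of Sudoku formulas and a Sudoku formula $\alpha$, $\Phi\vdash\alpha$ means there is a finite sequence $\phi_1,\dots,\phi_n=\alpha$ of Sudoku formulas such that each $\phi_i$ is in $\Delta_{ax}$, or in $\Phi$, or is obtained by modus ponens from earlier formulas (there are $p,q<i$ with $\phi_q$ equal to $\phi_p\Rightarrow\phi_i$). $\Phi\vdash\Psi$ means $\Phi\vdash\alpha$ for all $\alpha\in\Psi$. For a Sudoku grid $\mathcal{A}$ let $\mathrm{Prop}(\mathcal{A})=\{r_ic_j\not\approx d: 1\le i,j,d\le 9,\ d\notin A_{ij}\}$. A solution $\mathcal{S}$ of $\mathcal{A}$ is a logically deducible solution of $\mathcal{A}$ if $\mathrm{Prop}(\mathcal{A})\vdash\mathrm{Prop}(\mathcal{S})$. *)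

(* Defs.v *)
From HB Require Import structures.
From mathcomp Require Import all_boot all_algebra.

Set Implicit Arguments.
Unset Strict Implicit.
Unset Printing Implicit Defensive.

(* Rows, columns, boxes and digits are numbered 0, ..., 8, not 1, ..., 9. *)

(* [Neq i j d] is the Sudoku proposition stating that r_i c_j is not d. *)
Inductive formula : Type :=
| Neq of 'I_9 & 'I_9 & 'I_9
| Top
| Bot
| Not of formula
| And of formula & formula
| Or of formula & formula
| Imp of formula & formula
| Iff of formula & formula.

Record grid : Type := Grid {
  grid_mx :> 'M[{set 'I_9}]_9;
  grid_mx_neq0 : [forall i, forall j, grid_mx i j != set0]
}.

HB.instance Definition _ := [isSub for grid_mx].
HB.instance Definition _ := [Equality of grid by <:].

Definition full (A : grid) : Prop := forall i j, #|A i j| = 1.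

Fixpoint sat (A : grid) (phi : formula) : bool :=
  match phi with
  | Neq i j d => d \notin A i j
  | Top => true
  | Bot => false
  | Not f => ~~ sat A f
  | And f g => sat A f && sat A g
  | Or f g => sat A f || sat A g
  | Imp f g => sat A f ==> sat A g
  | Iff f g => sat A f == sat A g
  end.

(* Finite conjunctions are nested to the right and end with [Top]. *)

Definition is_digit (c : 'I_9 * 'I_9) (d : 'I_9) : formula :=
  \big[And/Top]_(s < 9 | s != d) Neq c.1 c.2 s.

Definition parallel (c c' : 'I_9 * 'I_9) : formula :=
  \big[And/Top]_(d < 9)
    And (Imp (is_digit c d) (Neq c'.1 c'.2 d))
        (Imp (is_digit c' d) (Neq c.1 c.2 d)).

Definition all_parallel (H : {set 'I_9 * 'I_9}) : formula :=
  \big[And/Top]_(p | [&& p.1 \in H, p.2 \in H & p.1 != p.2])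
    parallel p.1 p.2.

Definition row_cells (i : 'I_9) : {set 'I_9 * 'I_9} := [set c | c.1 == i].

Definition col_cells (j : 'I_9) : {set 'I_9 * 'I_9} := [set c | c.2 == j].

Definition box_cells (b : 'I_9) : {set 'I_9 * 'I_9} :=
  [set c : 'I_9 * 'I_9 | (c.1 %/ 3 == b %/ 3) && (c.2 %/ 3 == b %% 3)].

Inductive Sigma_ax : formula -> Prop :=
| Sigma_row i : Sigma_ax (all_parallel (row_cells i))
| Sigma_col j : Sigma_ax (all_parallel (col_cells j))
| Sigma_box b : Sigma_ax (all_parallel (box_cells b)).

Definition sudoku_grid (A : grid) : Prop := forall phi, Sigma_ax phi -> sat A phi.

Definition full_sudoku_grid (A : grid) : Prop := sudoku_grid A /\ full A.

Definition solution (A S : grid) : Prop :=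
  full_sudoku_grid S /\ forall i j, S i j \subset A i j.

Definition Delta_ax (phi : formula) : Prop :=
  forall A, full_sudoku_grid A -> sat A phi.

Definition derivation (Phi : formula -> Prop) (s : seq formula) : Prop :=
  forall i, i < size s ->
    [\/ Delta_ax (nth Top s i), Phi (nth Top s i) |
        exists p q, [/\ p < i, q < i &
                        nth Top s q = Imp (nth Top s p) (nth Top s i)]].

Definition derives (Phi : formula -> Prop) (alpha : formula) : Prop :=
  exists s, derivation Phi (rcons s alpha).

Definition derives_all (Phi Psi : formula -> Prop) : Prop :=
  forall alpha, Psi alpha -> derives Phi alpha.

Inductive Props (A : grid) : formula -> Prop :=
| Props_Neq i j d : d \notin A i j -> Props A (Neq i j d).

Definition deducible_solution (A S : grid) : Prop :=
  solution A S /\ derives_all (Props A) (Props S).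

(* Main.v *)
(* Modus ponens preserves truth in each full Sudoku grid.  Hence a solution T of
   A, which satisfies Prop(A), also satisfies Prop(S), i.e. every cell of T is
   included in the corresponding cell of S; as both are singletons, T = S. *)
Require Import Defs.
From mathcomp Require Import all_boot all_algebra.

(** Strong induction on the position in the derivation: axioms hold in [T] because it is a full
    Sudoku grid, and modus ponens cites only earlier positions. *)
Lemma derives_sound (Phi : formula -> Prop) (alpha : formula) (T : grid) :
  full_sudoku_grid T -> (forall phi, Phi phi -> sat T phi) ->
  derives Phi alpha -> sat T alpha.
Proof.
move=> fullT satPhi [s der_s].
have sat_nth i : i < size (rcons s alpha) -> sat T (nth Top (rcons s alpha) i).
  elim/ltn_ind: i => i IH lt_i.
  case: (der_s i lt_i) => [ax|/satPhi //|[p [q [lt_pi lt_qi q_imp]]]].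
    exact: ax.
  have := IH q lt_qi (ltn_trans lt_qi lt_i).
  by rewrite q_imp /= (IH p lt_pi (ltn_trans lt_pi lt_i)).
(* Index [size s] is the last one, where [alpha] stands. *)
have := sat_nth (size s); rewrite size_rcons nth_rcons ltnn eqxx.
exact.
Qed.

Lemma solution_sat_Props (A T : grid) (phi : formula) :
  solution A T -> Props A phi -> sat T phi.
Proof.
move=> [_ subTA] [i j d dNA] /=.
exact: contra (subsetP (subTA i j) d) dNA.
Qed.

Theorem theorem5p8 (A S : grid) (hA : sudoku_grid A) (hS : sudoku_grid S)
    (hAS : deducible_solution A S) :
  solution A S /\ forall T : grid, solution A T -> T = S.
Proof.
case: hAS => solS derS; split=> // T solT.
have [[_ fullS] _] := solS.
have [fsT _] := solT; have [_ fullT] := fsT.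
apply: val_inj; apply/matrixP => i j /=.
apply/eqP; rewrite eqEcard fullS fullT leqnn andbT.
(* Contraposition fits the shape of [Neq]: if [d] is not in [S i j], then [Neq i j d] lies in
   [Props S], so it is derivable from [Props A] and true in [T]. *)
apply/subsetP => d; apply: contraLR => dNS.
apply: (derives_sound (Props A) (Neq i j d) T fsT).
  by move=> phi; apply: solution_sat_Props.
by apply: derS; constructor.
Qed.
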